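(* Let $G$ be a finite group and let $\chi$ be a complex character of $G$ (the character of a finite-dimensional complex representation of $G$) such that $\chi(g)\in\mathbb{Z}$ for all $g\in G$. Then for every prime $p$, every integer $k\ge 1$ and every $g\in G$, $$\chi(g^{p^k})\equiv \chi(g^{p^{k-1}})\pmod{p^k}.$$ In particular, this congruence holds for every complex character of a symmetric group $S_n$ (for all $n$, all $g\in S_n$, all primes $p$ and all $k\ge 1$). *)

(* Defs.v *)
From HB Require Import structures.
From mathcomp Require Import all_boot all_order all_algebra all_fingroup.
From mathcomp Require Import mxrepresentation.
From mathcomp Require Import reals complex.

Set Implicit Arguments.
Unset Strict Implicit.
Unset Printing Implicit Defensive.

Import GRing.Theory.
Local Open Scope ring_scope.

(* The library's predicate [character] on 'CF(G) only covers representations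
   over the algebraic numbers algC; here the scalars are the complex numbers
   R[i].  Only the values of [chi] on [G] are constrained, and the degree [n]
   may be 0. *)
Definition complex_character (R : realType) (gT : finGroupType)
    (G : {group gT}) (chi : gT -> R[i]) : Prop :=
  exists (n : nat) (rG : mx_representation R[i] G n),
    forall g, g \in G -> chi g = \tr (rG g).

Definition is_integer (R : realType) (x : R[i]) : Prop :=
  exists a : int, x = a%:~R.

(* Congruence of complex numbers as rational integers: that [x] and [y] are
   integers is part of the assertion. *)
Definition int_congr (R : realType) (m : nat) (x y : R[i]) : Prop :=
  exists a b : int, [/\ x = a%:~R, y = b%:~R & (a = b %[mod m%:Z])%Z].

(* Main.v *)
(* Let N = #[g] and let z be a primitive N-th root of unity.  The eigenvalues of
   a matrix affording g are powers of z, and the multiplicity m(i) of z^i is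
   recovered from the values chi(g^j) by Fourier inversion on Z/N.  The key point
   is that m(i) depends only on gcd(i, N): if chi is integer valued because the
   cyclotomic polynomials are irreducible over the rationals, and in a symmetric
   group because g is conjugate to g^u for every u coprime to N.  Hence
   chi(g^j) = \sum_c m(c) R_c(j), where R_c(j) is the sum of the z^(i j) over the
   i with gcd(i, N) = c.  The sum of R_d(j) over the multiples d of c is N/c if
   N/c divides j and 0 otherwise; its values at p^k and p^(k-1) differ only when
   N/c = p^k, and then by p^k.  So they are congruent modulo p^k, and downward
   induction on c gives the same for R_c, hence for chi. *)

Require Import Defs.
From HB Require Import structures.
From mathcomp Require Import all_boot all_order all_algebra all_fingroup.
From mathcomp Require Import cyclic mxrepresentation separable algC cyclotomic.
From mathcomp Require Import reals complex.

Set Implicit Arguments.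
Unset Strict Implicit.
Unset Printing Implicit Defensive.

Import GRing.Theory Num.Theory.
Local Open Scope ring_scope.

(** * Conjugacy of primitive roots of unity over the rationals *)

Lemma map_poly_ratr_intr (F : numFieldType) (P : {poly int}) :
  map_poly (ratr : rat -> F) (map_poly intr P) = map_poly intr P.
Proof.
by rewrite -map_poly_comp; apply: eq_map_poly => a; rewrite /= rmorph_int.
Qed.

(** ['X^d - 1] factors into the ['Phi_e] for [e] dividing [d]; one of them vanishes at [z], and then
    [z ^+ e = 1] forces [e = d]. *)
Lemma root_Cyclotomic (F : numFieldType) (d : nat) (z : F) :
  d.-primitive_root z -> root (map_poly intr 'Phi_d) z.
Proof.
move=> prim_z; have d_gt0 := prim_order_gt0 prim_z.
have rootXn1 e : (e > 0)%N -> (z ^+ e == 1) =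
    has (fun f => root (map_poly intr 'Phi_f) z) (divisors e).
  move=> e_gt0; rewrite -subr_eq0.
  have -> : z ^+ e - 1 = (map_poly intr (\prod_(f <- divisors e) 'Phi_f)).[z].
    by rewrite prod_Cyclotomic // rmorphB rmorph1 /= map_polyXn !hornerE.
  by rewrite rmorph_prod horner_prod prodf_seq_eq0.
have := rootXn1 d d_gt0; rewrite (prim_expr_order prim_z) eqxx.
case/esym/hasP=> e; rewrite -dvdn_divisors // => e_dv_d root_e.
have e_gt0 := dvdn_gt0 d_gt0 e_dv_d.
suffices ze1: z ^+ e == 1.
  by rewrite -(eqP (_ : e == d)) // eqn_dvd e_dv_d (prim_order_dvd prim_z).
by rewrite rootXn1 //; apply/hasP; exists e; rewrite // -dvdn_divisors.
Qed.

(** The rational gcd of [P] and ['Phi_d] is not constant, since it vanishes at [z]. So it has a root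
    in [algC], a primitive [d]-th root of unity with minimal polynomial ['Phi_d]; hence ['Phi_d]
    divides [P]. *)
Lemma primitive_roots_conjugate (F : numFieldType) (d : nat) (z w : F)
    (P : {poly int}) :
  d.-primitive_root z -> d.-primitive_root w ->
  root (map_poly intr P) z -> root (map_poly intr P) w.
Proof.
move=> prim_z prim_w Pz.
pose toQ := map_poly (intr : int -> rat).
suffices /dvdpP[r Dr]: toQ 'Phi_d %| toQ P.
  rewrite -map_poly_ratr_intr -/(toQ P) Dr rmorphM rootM /=.
  by rewrite map_poly_ratr_intr root_Cyclotomic ?orbT.
have Phi_neq0 : toQ 'Phi_d != 0.
  have mon_Phi := Cyclotomic_monic d.
  by rewrite map_poly_eq0_id0 ?monic_neq0 // (monicP mon_Phi).
pose g := gcdp (toQ P) (toQ 'Phi_d).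
have g_neq0 : g != 0 by rewrite gcdp_eq0 negb_and Phi_neq0 orbT.
have root_g (K : numFieldType) (x : K) : root (map_poly ratr g) x =
    root (map_poly intr P) x && root (map_poly intr 'Phi_d) x.
  by rewrite gcdp_map root_gcd !map_poly_ratr_intr.
have /closed_rootP[x]: size (map_poly (ratr : rat -> algC) g) != 1.
  rewrite size_map_poly -(size_map_poly (ratr : rat -> F)).
  have gz : root (map_poly (ratr : rat -> F) g) z by rewrite root_g Pz root_Cyclotomic.
  by rewrite gtn_eqF // (root_size_gt1 _ gz) // map_poly_eq0.
rewrite root_g => /andP[Px].
have [x0 prim_x0] := C_prim_root_exists (prim_order_gt0 prim_z).
rewrite (Cintr_Cyclotomic prim_x0) root_cyclotomic // => prim_x.
have [q [Dq _] dv_q] := minCpolyP x.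
suffices -> : toQ 'Phi_d = q by rewrite -dv_q map_poly_ratr_intr.
apply: (map_poly_inj (ratr : {rmorphism rat -> algC})).
by rewrite map_poly_ratr_intr -Dq (minCpoly_cyclotomic prim_x) (Cintr_Cyclotomic prim_x).
Qed.

(** * Eigenvalues of a matrix of finite order and Fourier inversion *)

(** ['X^N - 1] annihilates [A] and is separable in characteristic 0, so [A] is diagonalizable. *)
Lemma mxtrace_expr_finite_order (F : numClosedFieldType) (n N : nat)
    (A : 'M[F]_n) :
  (N > 0)%N -> A ^+ N = 1 ->
  exists2 lam : 'I_n -> F, forall l, lam l ^+ N = 1 &
    forall j, \tr (A ^+ j) = \sum_l lam l ^+ j.
Proof.
case: n A => [|n] A N_gt0 AN1.
  by exists (fun=> 0) => [[]//|j]; rewrite /mxtrace !big_ord0.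
pose p : {poly F} := 'X^N - 1; have [rs Dp] := closed_field_poly_normal p.
rewrite (monicP _) ?monicXnsubC // scale1r in Dp.
have /(diagonalizableP A) [P Pu /(diagonalizable_forLR Pu)[D DA]] :
    exists2 rs, uniq rs & mxminpoly A %| \prod_(x <- rs) ('X - x%:P).
  exists rs.
    rewrite -separable_prod_XsubC -Dp separable_Xn_sub_1 //.
    by rewrite pnatr_eq0 -lt0n.
  rewrite -Dp; apply: mxminpoly_min.
  by rewrite rmorphB rmorph1 rmorphXn /= horner_mx_X AN1 subrr.
have DX j : A ^+ j = invmx P *m diag_mx (map_mx (fun x => x ^+ j) D) *m P.
  have -> : A = invmx P *m diag_mx D *m P by rewrite DA mxpoly.conjumx ?unitmx_inv ?invmxK.
  elim: j => [|j IHj].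
    rewrite expr0; have -> : map_mx (fun x => x ^+ 0) D = const_mx 1.
      by apply/matrixP=> a b; rewrite !mxE.
    by rewrite diag_const_mx mulmx1 mulVmx.
  rewrite exprSr {}IHj -!mulmxE !mulmxA mulmxK //.
  rewrite -(mulmxA (invmx P) (diag_mx _) (diag_mx _)) mulmx_diag.
  congr (_ *m diag_mx _ *m _).
  by apply/matrixP=> a b; rewrite !mxE ord1 exprSr.
exists (D 0) => [l|j].
  have := DX N; rewrite AN1 => /(congr1 (fun B => P *m B *m invmx P)).
  rewrite !mulmxA mulmxK // mulmxV // mul1mx mulmx1 mulmxV //.
  by move/matrixP/(_ l l); rewrite !mxE eqxx.
rewrite DX mxtrace_mulC mulmxA mulmxV // mul1mx mxtrace_diag.
by apply: eq_bigr => l _; rewrite mxE.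
Qed.

Lemma sum_expr_unity_root (F : fieldType) (N : nat) (x : F) : x ^+ N = 1 ->
  \sum_(j < N) x ^+ j = if x == 1 then N%:R else 0.
Proof.
move=> xN1; have [->|x_neq1] := eqVneq.
  by under eq_bigr do rewrite expr1n; rewrite sumr_const card_ord.
apply: (mulfI (_ : x - 1 != 0)); first by rewrite subr_eq0.
by rewrite -subrX1 xN1 subrr mulr0.
Qed.

(** Orthogonality: the powers of [lam l / mu] sum to [N] or to 0. Here [mu ^+ (N - j)] stands for
    the inverse of [mu ^+ j], which keeps the right side polynomial in [mu]. *)
Lemma multiplicity_fourier (F : fieldType) (n N : nat) (lam : 'I_n -> F)
    (mu : F) :
  (N > 0)%N -> (forall l, lam l ^+ N = 1) -> mu ^+ N = 1 ->
  #|[pred l | lam l == mu]|%:R * N%:R =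
    \sum_(j < N) (\sum_l lam l ^+ j) * mu ^+ (N - j).
Proof.
move=> N_gt0 lamN1 muN1.
have mu_neq0 : mu != 0.
  by apply: contra_eq_neq muN1 => ->; rewrite expr0n gtn_eqF // eq_sym oner_neq0.
under eq_bigr do rewrite mulr_suml.
rewrite exchange_big /= mulr_natl -sumr_const big_mkcond.
apply: eq_bigr => l _; rewrite inE.
have -> : (lam l == mu) = (lam l / mu == 1).
  by rewrite -(can_eq (mulfK mu_neq0)) mul1r divfK //.
rewrite -sum_expr_unity_root; last by rewrite expr_div_n lamN1 muN1 divr1.
apply: eq_bigr => j _.
by rewrite expfB // muN1 expr_div_n div1r.
Qed.


(** * Integer congruences inside a ring *)

(* Generalizes [int_congr], to which it is convertible at [F := R[i]]. *)
Definition integer_congr (F : pzRingType) (m : nat) (x y : F) : Prop :=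
  exists a b : int, [/\ x = a%:~R, y = b%:~R & (a = b %[mod m%:Z])%Z].

Section IntegerCongr.
Context (F : pzRingType) (m : nat).
Implicit Types x y : F.

Lemma integer_congr0 : integer_congr m (0 : F) 0.
Proof. by exists 0, 0. Qed.

Lemma integer_congrD x y x' y' :
  integer_congr m x y -> integer_congr m x' y' ->
  integer_congr m (x + x') (y + y').
Proof.
move=> [a [b [-> -> ab]]] [a' [b' [-> -> ab']]].
exists (a + a'), (b + b'); rewrite !rmorphD; split=> //.
by rewrite -modzDm ab ab' modzDm.
Qed.

Lemma integer_congrN x y : integer_congr m x y -> integer_congr m (- x) (- y).
Proof.
move=> [a [b [-> -> ab]]]; exists (- a), (- b); rewrite !rmorphN; split=> //.
by rewrite -modzNm ab modzNm.
Qed.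

Lemma integer_congrMn x y n :
  integer_congr m x y -> integer_congr m (x *+ n) (y *+ n).
Proof.
move=> xy; elim: n => [|n IHn]; first by rewrite !mulr0n; apply: integer_congr0.
by rewrite !mulrS; apply: integer_congrD.
Qed.

Lemma integer_congr_sum (I : Type) (r : seq I) (P : pred I) (f g : I -> F) :
  (forall i, P i -> integer_congr m (f i) (g i)) ->
  integer_congr m (\sum_(i <- r | P i) f i) (\sum_(i <- r | P i) g i).
Proof.
move=> fg; apply: (big_ind2 (integer_congr m)) => //.
- exact: integer_congr0.
- by move=> *; apply: integer_congrD.
Qed.

End IntegerCongr.

(** * Sums of roots of unity over a gcd class *)

(** For [z] a primitive [N]-th root of unity and [c] dividing [N], this is the classical Ramanujan
    sum of modulus [N / c] at [j]. *)
Definition ramanujan_sum (F : pzRingType) (N : nat) (z : F) (c j : nat) : F :=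
  \sum_(i < N | gcdn i N == c) z ^+ (i * j).

(** The range of [c] has to include [N], the gcd attained at [i = 0]. *)
Lemma partition_gcd (F : pzRingType) (N : nat) (P : pred nat) (f : nat -> F) :
  (N > 0)%N ->
  \sum_(i < N | P (gcdn i N)) f i =
  \sum_(c < N.+1 | P c) \sum_(i < N | gcdn i N == c) f i.
Proof.
move=> N_gt0.
have lt_gcd (i : 'I_N) : (gcdn i N < N.+1)%N by rewrite ltnS dvdn_leq ?dvdn_gcdr.
rewrite (partition_big (fun i => Ordinal (lt_gcd i)) (fun c : 'I_N.+1 => P c)) //.
apply: eq_bigr => c Pc; apply: eq_bigl => i /=.
rewrite -(inj_eq val_inj) /=; case: eqP => [->|_]; last by rewrite andbF.
by rewrite Pc.
Qed.

(** Writing [i = t * c] gives a geometric sum of [N / c] powers of [z ^+ (c * j)], itself a root of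
    unity of order dividing [N / c]. *)
Lemma sum_expr_dvd (F : fieldType) (N c j : nat) (z : F) :
  N.-primitive_root z -> (c %| N)%N ->
  \sum_(i < N | (c %| gcdn i N)%N) z ^+ (i * j) =
    if (N %| c * j)%N then (N %/ c)%:R else 0.
Proof.
move=> prim_z c_dv_N; have N_gt0 := prim_order_gt0 prim_z.
have c_gt0 := dvdn_gt0 N_gt0 c_dv_N.
have DN := divnK c_dv_N.
rewrite (prim_order_dvd prim_z) -sum_expr_unity_root; last first.
  by rewrite -exprM mulnC mulnA DN exprM (prim_expr_order prim_z) expr1n.
have lt_mul (t : 'I_(N %/ c)) : (t * c < N)%N.
  by rewrite -{2}DN ltn_pmul2r.
have lt_div (i : 'I_N) : (i %/ c < N %/ c)%N by rewrite ltn_divLR // DN.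
rewrite (reindex_onto (fun t => Ordinal (lt_mul t)) (fun i => Ordinal (lt_div i))).
  apply: eq_big => [t|t _] /=; last by rewrite -exprM -mulnA mulnC.
  by rewrite dvdn_gcd c_dv_N dvdn_mull // -(inj_eq val_inj) /= mulnK // eqxx.
move=> i; rewrite dvdn_gcd => /andP[c_dv_i _]; apply: val_inj => /=.
by rewrite divnK.
Qed.

Lemma sum_expr_dvd_congr (F : fieldType) (N c p k : nat) (z : F) :
  N.-primitive_root z -> (c %| N)%N -> prime p -> (0 < k)%N ->
  integer_congr (p ^ k)%N
    (\sum_(i < N | (c %| gcdn i N)%N) z ^+ (i * p ^ k))
    (\sum_(i < N | (c %| gcdn i N)%N) z ^+ (i * p ^ (k - 1))).
Proof.
move=> prim_z c_dv_N p_pr k_gt0; have N_gt0 := prim_order_gt0 prim_z.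
have c_gt0 := dvdn_gt0 N_gt0 c_dv_N.
have dvN e : (N %| c * e)%N = (N %/ c %| e)%N.
  by rewrite -{1}(divnK c_dv_N) mulnC dvdn_pmul2l.
rewrite !(sum_expr_dvd _ prim_z) // !dvN; set e := (N %/ c)%N.
have [dv_k1|ndv_k1] := boolP (e %| p ^ (k - 1))%N.
  have -> : (e %| p ^ k)%N by rewrite (dvdn_trans dv_k1) // dvdn_exp2l ?leq_subr.
  by exists e%:Z, e%:Z; rewrite pmulrn.
have [/(dvdn_pfactor _ _ p_pr)[a le_a_k De]|_] := boolP (e %| p ^ k)%N; last first.
  exact: integer_congr0.
(* A smaller exponent [a] would make [e] divide [p ^ (k - 1)]. *)
have Da : a = k.
  apply/eqP; rewrite eqn_leq le_a_k leqNgt; apply: contra ndv_k1 => lt_a_k.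
  by rewrite De dvdn_exp2l // subn1 -ltnS prednK.
exists e%:Z, 0; rewrite pmulrn De Da; split=> //.
by rewrite modzz mod0z.
Qed.

Lemma ramanujan_sum_congr (F : fieldType) (N c p k : nat) (z : F) :
  N.-primitive_root z -> prime p -> (0 < k)%N ->
  integer_congr (p ^ k)%N (ramanujan_sum N z c (p ^ k))
                          (ramanujan_sum N z c (p ^ (k - 1))).
Proof.
move=> prim_z p_pr k_gt0; have N_gt0 := prim_order_gt0 prim_z.
(* Induction on [N - c] runs downward in [c], so the proper multiples of [c] come first. *)
have [m] := ubnP (N - c); elim: m c => // m IHm c le_m.
have [c_dv_N|ndv_c] := boolP (c %| N)%N; last first.
  rewrite /ramanujan_sum !big_pred0 => [|i|i]; first exact: integer_congr0.
  1,2: by apply: contraNF ndv_c => /eqP<-; apply: dvdn_gcdr.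
have lt_c : (c < N.+1)%N by rewrite ltnS dvdn_leq.
have DR j : ramanujan_sum N z c j =
    \sum_(i < N | (c %| gcdn i N)%N) z ^+ (i * j) -
    \sum_(d < N.+1 | (c %| d)%N && (d != Ordinal lt_c)) ramanujan_sum N z d j.
  rewrite (partition_gcd (fun d => c %| d)%N (fun i => z ^+ (i * j))) //.
  by rewrite (bigD1 (Ordinal lt_c)) //= addrK.
rewrite !DR; apply: integer_congrD; first exact: sum_expr_dvd_congr.
apply/integer_congrN/integer_congr_sum => d /andP[c_dv_d d_neq_c].
(* The index [d = 0] is also a multiple of [c], but no gcd with [N] is 0, so both sums are empty. *)
have [d0|d_gt0] := posnP d.
  rewrite /ramanujan_sum !big_pred0 => [|i|i]; first exact: integer_congr0.
  1,2: by rewrite d0 eqn0Ngt gcdn_gt0 N_gt0 orbT.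
have lt_c_d : (c < d)%N.
  by rewrite ltn_neqAle dvdn_leq // andbT eq_sym.
have le_d_N : (d <= N)%N by rewrite -ltnS ltn_ord.
apply: IHm; rewrite -ltnS; apply: leq_trans le_m; rewrite ltnS.
exact: ltn_sub2l (leq_trans lt_c_d le_d_N) lt_c_d.
Qed.

(** * Power sums with multiplicities constant on gcd classes *)

Definition multiplicity (T : eqType) (n : nat) (lam : 'I_n -> T) (x : T) : nat :=
  #|[pred l | lam l == x]|.

Lemma power_sum_congr (F : fieldType) (n N p k : nat) (lam : 'I_n -> F) (z : F) :
  N.-primitive_root z -> (forall l, lam l ^+ N = 1) ->
  (forall i, multiplicity lam (z ^+ i) = multiplicity lam (z ^+ gcdn i N)) ->
  prime p -> (0 < k)%N ->
  integer_congr (p ^ k)%N (\sum_l lam l ^+ (p ^ k)%N)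
                          (\sum_l lam l ^+ (p ^ (k - 1))%N).
Proof.
move=> prim_z lamN1 mult_gcd p_pr k_gt0; have N_gt0 := prim_order_gt0 prim_z.
pose idx l : 'I_N := sval (prim_rootP prim_z (lamN1 l)).
have Dlam l : lam l = z ^+ idx l by rewrite /idx; case: prim_rootP.
(* The indices [l] are grouped by the exponent of [lam l], then the exponents by gcd; [mult_gcd]
   lets the multiplicity leave the inner sum. *)
have Ds j : \sum_l lam l ^+ j =
    \sum_(c < N.+1) ramanujan_sum N z c j *+ multiplicity lam (z ^+ c).
  rewrite (partition_big idx xpredT) //=.
  have := @partition_gcd F N xpredT
            (fun i => z ^+ (i * j) *+ multiplicity lam (z ^+ i)) N_gt0.
  rewrite /=; under [in X in _ = X -> _]eq_bigr => c _.
    under eq_bigr => i /eqP Dc do rewrite mult_gcd Dc.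
    rewrite sumrMnl; over.
  move=> <-; apply: eq_bigr => i _.
  rewrite /multiplicity -sumr_const; apply: eq_big => [l|l /eqP <-].
    rewrite inE Dlam (eq_prim_root_expr prim_z) !modn_small //.
  by rewrite exprM -Dlam.
by rewrite !Ds; apply: integer_congr_sum => c _; apply/integer_congrMn/ramanujan_sum_congr.
Qed.


(** * Two criteria for multiplicities to depend only on the gcd *)

Lemma primitive_root_exists (F : numClosedFieldType) (N : nat) :
  (N > 0)%N -> exists z : F, N.-primitive_root z.
Proof.
pose p : {poly F} := 'X^N - 1; have [r Dp] := closed_field_poly_normal p.
move=> N_gt0; rewrite (monicP _) ?monicXnsubC // scale1r in Dp.
have rn1: all N.-unity_root r by apply/allP=> z; rewrite -root_prod_XsubC -Dp.
have lt_N_r : (N < (size r).+1)%N.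
  by rewrite -(size_prod_XsubC r id) -Dp size_XnsubC.
have [|z _ prim_z] := hasP (has_prim_root N_gt0 rn1 _ lt_N_r); last by exists z.
by rewrite -separable_prod_XsubC -Dp separable_Xn_sub_1 // pnatr_eq0 -lt0n.
Qed.

Lemma eq_multiplicity_of_power_sums (F : numFieldType) (n N : nat)
    (lam lam' : 'I_n -> F) (x : F) :
  (N > 0)%N -> (forall l, lam l ^+ N = 1) -> (forall l, lam' l ^+ N = 1) ->
  x ^+ N = 1 -> (forall j, \sum_l lam l ^+ j = \sum_l lam' l ^+ j) ->
  multiplicity lam x = multiplicity lam' x.
Proof.
move=> N_gt0 lamN1 lam'N1 xN1 eq_sums; apply/eqP; rewrite -(eqr_nat F).
have /mulIf/inj_eq<- : N%:R != 0 :> F by rewrite pnatr_eq0 -lt0n.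
rewrite !(multiplicity_fourier N_gt0) //; apply/eqP/eq_bigr => j _.
by rewrite eq_sums.
Qed.

(** Fourier inversion, with the power sums as integer coefficients, yields an integer polynomial [P]
    that vanishes at an [N]-th root of unity exactly when its multiplicity is that of [z]. Conjugacy
    carries the root [z] of [P] to [w]. *)
Lemma multiplicity_conjugate (F : numFieldType) (n N d : nat)
    (lam : 'I_n -> F) (z w : F) :
  (N > 0)%N -> (forall l, lam l ^+ N = 1) -> z ^+ N = 1 -> w ^+ N = 1 ->
  (forall j, exists a : int, \sum_l lam l ^+ j = a%:~R) ->
  d.-primitive_root z -> d.-primitive_root w ->
  multiplicity lam z = multiplicity lam w.
Proof.
move=> N_gt0 lamN1 zN1 wN1 int_sums prim_z prim_w.
have [a Da] := fin_all_exists (fun j : 'I_N => int_sums j).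
pose P : {poly int} := \sum_(j < N) (a j)%:P * 'X^(N - j)
                       - ((multiplicity lam z * N)%N : int)%:P.
have DP x : x ^+ N = 1 -> (map_poly intr P).[x] =
    ((multiplicity lam x * N)%N%:R - (multiplicity lam z * N)%N%:R : F).
  move=> xN1; rewrite rmorphB rmorph_sum /= hornerD hornerN map_polyC hornerC /=.
  rewrite -!pmulrn [X in _ = X%:R - _]/= natrM (multiplicity_fourier N_gt0) //.
  congr (_ - _); rewrite horner_sum; apply: eq_bigr => j _.
  by rewrite rmorphM /= map_polyC map_polyXn hornerM hornerC hornerXn Da.
have Pz : root (map_poly intr P) z by rewrite rootE DP // subrr.
have := primitive_roots_conjugate prim_z prim_w Pz.
by rewrite rootE DP // subr_eq0 eqr_nat eqn_pmul2r // => /eqP.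
Qed.

(** Both powers of [z] are primitive roots of the same order [N / gcdn i N]. *)
Lemma multiplicity_gcd_of_integer_sums (F : numFieldType) (n N i : nat)
    (lam : 'I_n -> F) (z : F) :
  N.-primitive_root z -> (forall l, lam l ^+ N = 1) ->
  (forall j, exists a : int, \sum_l lam l ^+ j = a%:~R) ->
  multiplicity lam (z ^+ i) = multiplicity lam (z ^+ gcdn i N).
Proof.
move=> prim_z lamN1 int_sums; have N_gt0 := prim_order_gt0 prim_z.
have zXN j : (z ^+ j) ^+ N = 1 by rewrite exprAC (prim_expr_order prim_z) expr1n.
apply: (multiplicity_conjugate N_gt0 lamN1) (exp_prim_root prim_z i) _ => //.
by have := exp_prim_root prim_z (gcdn i N); rewrite -gcdnA gcdnn.
Qed.

(* With c = gcd(i, N), lifts the unit i/c modulo N/c to a unit modulo N: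
   u = i/c + (N/c) t, where t collects the primes of N not dividing i/c, so that
   each prime of N divides exactly one of the two summands. *)
Lemma gcdn_mul_coprime (i N : nat) : (N > 0)%N ->
  exists2 u, coprime u N & (gcdn i N * u = i %[mod N])%N.
Proof.
move=> N_gt0; have [->|i_gt0] := posnP i.
  by exists 1%N; rewrite ?coprime1n // gcd0n muln1 modnn mod0n.
set c := gcdn i N; have c_gt0 : (c > 0)%N by rewrite gcdn_gt0 i_gt0.
pose i' := (i %/ c)%N; pose N' := (N %/ c)%N.
have Di : i = (c * i')%N by rewrite mulnC divnK ?dvdn_gcdl.
have DN : N = (c * N')%N by rewrite mulnC divnK ?dvdn_gcdr.
have i'_gt0 : (i' > 0)%N by move: i_gt0; rewrite Di muln_gt0 => /andP[].
have co_i'N' : coprime i' N'.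
  by rewrite /coprime -(eqn_pmul2l c_gt0) muln_gcdr -Di -DN muln1.
pose t := (N`_(\pi(i')^'))%N.
exists (i' + N' * t)%N; last by rewrite mulnDr -Di mulnA -DN addnC (mulnC N) modnMDl.
rewrite coprime_sym coprime_has_primes ?addn_gt0 ?i'_gt0 //.
apply/hasPn => q; rewrite !mem_primes => /and3P[q_pr _ q_dv_u].
apply: contraTN q_dv_u => /and3P[_ _ q_dv_N].
have [q_dv_i'|q_ndv_i'] := boolP (q %| i')%N.
  rewrite dvdn_addr // Euclid_dvdM // negb_or; apply/andP; split.
    by rewrite -prime_coprime // (coprime_dvdl q_dv_i').
  rewrite -prime_coprime //; apply: (@pnat_coprime \pi(i')); last exact: part_pnat.
  by rewrite pnatE // mem_primes q_pr i'_gt0.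
rewrite dvdn_addl // dvdn_mull //.
have pi'_q : (\pi(i')^').-nat q.
  by rewrite pnatE // inE /= mem_primes q_pr i'_gt0.
by rewrite -(part_pnat_id pi'_q) partn_dvd.
Qed.

(** With [z ^+ i] written as the [u]-th power of [z ^+ gcdn i N], replacing [lam] by its [u]-th
    powers keeps all power sums, hence all multiplicities; and raising to the power [u] is injective
    on [N]-th roots of unity. *)
Lemma multiplicity_gcd_of_coprime_power (F : numFieldType) (n N i : nat)
    (lam : 'I_n -> F) (z : F) :
  N.-primitive_root z -> (forall l, lam l ^+ N = 1) ->
  (forall u j, coprime u N -> \sum_l lam l ^+ (u * j) = \sum_l lam l ^+ j) ->
  multiplicity lam (z ^+ i) = multiplicity lam (z ^+ gcdn i N).
Proof.
move=> prim_z lamN1 sums_u; have N_gt0 := prim_order_gt0 prim_z.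
have [u co_u_N Du] := gcdn_mul_coprime i N_gt0.
have prim_zu : N.-primitive_root (z ^+ u) by rewrite prim_root_exp_coprime.
have -> : z ^+ i = z ^+ (gcdn i N * u).
  by apply/eqP; rewrite (eq_prim_root_expr prim_z) Du.
have xN1 j : (z ^+ j) ^+ N = 1 by rewrite exprAC (prim_expr_order prim_z) expr1n.
rewrite (@eq_multiplicity_of_power_sums F n N lam (fun l => lam l ^+ u)) //.
- apply: eq_card => l; rewrite !inE.
  have [a ->] := prim_rootP prim_z (lamN1 l).
  rewrite -exprM mulnC [(_ * u)%N]mulnC !exprM (eq_prim_root_expr prim_zu).
  by rewrite (eq_prim_root_expr prim_z).
- by move=> l; rewrite exprAC lamN1 expr1n.
- by move=> j; under [RHS]eq_bigr do rewrite -exprM; rewrite sums_u.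
Qed.

(** * Conjugacy of a permutation with its coprime powers *)

(** For [i <= j], [g ^+ (j - i)] fixes [x], hence so does its [w]-th power. Exponents along a cycle
    can thus be scaled although they are only defined modulo its length. *)
Lemma perm_expg_stable (T : finType) (g : {perm T}) (w i j : nat) (x : T) :
  (g ^+ i)%g x = (g ^+ j)%g x -> (g ^+ (w * i))%g x = (g ^+ (w * j))%g x.
Proof.
wlog le_ij : i j / (i <= j)%N => [IH|] eq_ij.
  by have [/IH|/ltnW/IH] := leqP i j; [apply | move/(_ (esym eq_ij))].
have fix_x : (g ^+ (j - i))%g x = x.
  by apply: (@perm_inj _ (g ^+ i)%g); rewrite -permM -expgD subnK.
have -> : (w * j = w * (j - i) + w * i)%N by rewrite -mulnDr subnK.
rewrite expgD permM; congr (_ _).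
rewrite mulnC expgM permX; elim: w => //= w <-.
by rewrite fix_x.
Qed.

(* Each cycle is relabelled from its root: [g ^+ k] of the root is sent to
   [g ^+ (u * k)] of the root. *)
Lemma perm_expg_conjugate (T : finType) (g : {perm T}) (u : nat) :
  coprime u #[g]%g -> exists h : {perm T}, (g ^+ u = g ^ h)%g.
Proof.
rewrite coprime_sym -generator_coprime => /eqP gen_u.
(* [v] inverts [u] modulo the order of [g]; scaling exponents by [v] undoes [h] and gives its
   injectivity. *)
have /cycleP[v Dv] : g \in <[g ^+ u]>%g by rewrite -gen_u cycle_id.
have sym_g : connect_sym (frel g) by apply: fconnect_sym; apply: perm_inj.
pose r y := froot g y; pose k y := findex g (r y) y.
have Dk y : (g ^+ k y)%g (r y) = y.
  by rewrite permX iter_findex // sym_g connect_root.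
have rX i y : r ((g ^+ i)%g y) = r y.
  by apply/esym/(fingraph.rootP sym_g); rewrite permX fconnect_iter.
have rg y : r (g y) = r y := rX 1%N y.
have rr y : r (r y) = r y by apply: root_root.
pose h y := (g ^+ (u * k y))%g (r y).
have h_inj : injective h.
  move=> y y' eq_h; have eq_r : r y = r y'.
    by have := congr1 r eq_h; rewrite /h !rX !rr.
  move: eq_h; rewrite /h eq_r => /(perm_expg_stable v).
  rewrite !(mulnA v) (mulnC v) ![(g ^+ (u * v * _))%g]expgM !expgM -!Dv.
  by rewrite -{1}eq_r !Dk.
exists (perm h_inj); apply: (mulgI (perm h_inj)); rewrite -conjgC.
apply/permP => x; rewrite !permM !permE /h rg -permM -expgD.
have -> : (u * k x + u = u * (k x).+1)%N by rewrite mulnS addnC.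
apply: perm_expg_stable.
by rewrite expgSr permM Dk -(rg x) Dk.
Qed.


(** * Application to characters *)

Lemma repr_eigenvalues (F : numClosedFieldType) (gT : finGroupType)
    (G : {group gT}) (n : nat) (rG : mx_representation F G n) (g : gT) :
  g \in G ->
  exists2 lam : 'I_n -> F, forall l, lam l ^+ #[g]%g = 1 &
    forall j, \tr (rG (g ^+ j)%g) = \sum_l lam l ^+ j.
Proof.
move=> Gg; have rgX j : rG (g ^+ j)%g = rG g ^+ j.
  elim: j => [|j IHj]; first by rewrite expg0 repr_mx1.
  by rewrite expgSr exprSr repr_mxM ?groupX // IHj.
have rgN1 : rG g ^+ #[g]%g = 1 by rewrite -rgX expg_order repr_mx1.
have [lam lamN1 tr_lam] := mxtrace_expr_finite_order (order_gt0 g) rgN1.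
by exists lam => // j; rewrite rgX.
Qed.

Theorem theorem9 (R : realType) :
  (forall (gT : finGroupType) (G : {group gT}) (chi : gT -> R[i]%C),
      complex_character G chi ->
      (forall g, g \in G -> is_integer (chi g)) ->
      forall (p k : nat) (g : gT), prime p -> (1 <= k)%N -> g \in G ->
        int_congr (p ^ k)%N (chi (g ^+ (p ^ k)%N)%g)
                            (chi (g ^+ (p ^ (k - 1))%N)%g))
  /\
  (forall (n : nat) (chi : 'S_n -> R[i]%C),
      complex_character [set: 'S_n]%G chi ->
      forall (p k : nat) (g : 'S_n), prime p -> (1 <= k)%N ->
        int_congr (p ^ k)%N (chi (g ^+ (p ^ k)%N)%g)
                            (chi (g ^+ (p ^ (k - 1))%N)%g)).
Proof.
split=> [gT G chi [n [rG chiE]] int_chi p k g p_pr k_gt0 Gg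
        |m chi [n [rG chiE]] p k g p_pr k_gt0].
  have [lam lamN1 tr_lam] := repr_eigenvalues rG Gg.
  have [z prim_z] := @primitive_root_exists R[i] _ (order_gt0 g).
  have chi_lam j : chi (g ^+ j)%g = \sum_l lam l ^+ j.
    by rewrite chiE ?groupX.
  rewrite !chi_lam; apply: (power_sum_congr prim_z) => // i.
  apply: multiplicity_gcd_of_integer_sums => // j.
  by rewrite -chi_lam; apply/int_chi/groupX.
(* For the symmetric group, conjugacy of [g] with [g ^+ u] takes the place of integer values. *)
have inT h : h \in [set: 'S_m]%G by rewrite inE.
have [lam lamN1 tr_lam] := repr_eigenvalues rG (inT g).
have [z prim_z] := @primitive_root_exists R[i] _ (order_gt0 g).
rewrite !chiE ?inE // !tr_lam; apply: (power_sum_congr prim_z) => // i.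
apply: multiplicity_gcd_of_coprime_power => // u j co_u.
have [h Dh] := perm_expg_conjugate co_u.
(* [g ^+ (u * j)] is the conjugate of [g ^+ j] by [h], and the trace is invariant under
   conjugation. *)
rewrite -!tr_lam expgM Dh -conjXg conjgE !repr_mxM ?inE //.
by rewrite mxtrace_mulC -mulmxA -repr_mxM ?inE // mulgV repr_mx1 mulmx1.
Qed.
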